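(* The unprotected-sensor placement problem $$\underset{\mathcal{Y}_p\subseteq\mathcal{Y}_s}{\text{minimize}}\ |\mathcal{Y}_p|\qquad\text{subject to}\quad G(\mathcal{Y}_p)\ge\sum_{u_i\in\mathcal{U}}k_{u_i}$$ is an instance of the submodular problem $$\underset{\mathcal{X}_p}{\text{minimize}}\ |\mathcal{X}_p|\qquad\text{subject to}\quad F(\mathcal{X}_p)\ge F_{\max},$$ where $\mathcal{X}_p$ ranges over subsets of a finite non-empty ground set, $F$ is a nondecreasing, submodular, integer-valued set function on subsets of the ground set with $F(\emptyset)=0$, and $F_{\max}\in\mathbb{Z}_{\ge0}$. That is, with ground set $\mathcal{Y}_s$, $F=G$ and $F_{\max}=\sum_{u_i\in\mathcal{U}}k_{u_i}$, the function $G$ is submodular, nondecreasing, integer valued, and satisfies $G(\emptyset)=0$.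
   Context: Graph. Let $[A]\in\{0,1\}^{n_x\times n_x}$ and $[B]\in\{0,1\}^{n_x\times n_u}$, where the columns of $[B]$ are distinct canonical basis vectors. $\mathcal{X}=\{x_1,\dots,x_{n_x}\}$ (states), $\mathcal{U}=\{u_1,\dots,u_{n_u}\}$ (actuators), with directed edges $(u_j,x_i)$ when $[B](i,j)\neq0$ and $(x_j,x_i)$ when $[A](i,j)\ne0$. Two nodes are adjacent if there is an edge between them. For an actuator $u_i$, $\mathcal{X}_{u_i}\subseteq\mathcal{X}$ is the set of all states $x_k$ for which there exists a directed path $u_i,x_j,\dots,x_k$ in which none of the states is adjacent to an actuator from $\mathcal{U}\setminus\{u_i\}$. Placement problem. $\mathcal{Y}_s=\{y_1,\dots,y_{n_s}\}$ is a finite non-empty set of candidate unprotected sensors, $x_{y_j}\in\mathcal{X}$ is the state measured by $y_j$, and $k_{u_i}\in\mathbb{Z}_{\ge0}$ is given for each $u_i\in\mathcal{U}$. For $\mathcal{Y}_p\subseteq\mathcal{Y}_s$, $$g_{u_i}(\mathcal{Y}_p)=\min\Big\{\sum_{y_j\in\mathcal{Y}_p}|\{x_{y_j}\}\cap\mathcal{X}_{u_i}|,\ k_{u_i}\Big\},\qquad G(\mathcal{Y}_p)=\sum_{u_i\in\mathcal{U}}g_{u_i}(\mathcal{Y}_p).$$ Set functions. $F:2^{\mathcal{S}}\to\mathbb{R}$ is submodular if $F(\mathcal{S}_a\cup\{s\})-F(\mathcal{S}_a)\ge F(\mathcal{S}_b\cup\{s\})-F(\mathcal{S}_b)$ for all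 $\mathcal{S}_a\subseteq\mathcal{S}_b\subseteq\mathcal{S}$ and $s\in\mathcal{S}\setminus\mathcal{S}_b$, and nondecreasing if $F(\mathcal{S}_a)\le F(\mathcal{S}_b)$ for all $\mathcal{S}_a\subseteq\mathcal{S}_b\subseteq\mathcal{S}$. *)

(* Defs.v *)
From mathcomp Require Import all_boot all_order all_algebra.
From mathcomp Require Import boolp reals.

Set Implicit Arguments.
Unset Strict Implicit.
Unset Printing Implicit Defensive.

Import Order.TTheory GRing.Theory Num.Theory.
Local Open Scope ring_scope.

(* {0,1}-matrices are boolean matrices: a nonzero entry is [true]. *)

Definition distinct_canonical_columns (m n : nat) (B : 'M[bool]_(m, n)) : Prop :=
  (forall j : 'I_n, exists i : 'I_m, col j B = \col_k (k == i)) /\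
  injective (fun j : 'I_n => col j B).

(* [inl x] is a state and [inr u] an actuator. *)
Definition node (nx nu : nat) : Type := ('I_nx + 'I_nu)%type.

Definition edge (nx nu : nat) (A : 'M[bool]_nx) (B : 'M[bool]_(nx, nu))
    : rel (node nx nu) := fun v w =>
  match v, w with
  | inr j, inl i => B i j
  | inl j, inl i => A i j
  | _, inr _ => false
  end.

Definition adjacent (nx nu : nat) (A : 'M[bool]_nx) (B : 'M[bool]_(nx, nu))
    : rel (node nx nu) := fun v w => edge A B v w || edge A B w v.

(* The directed path is u, x, p_1, p_2, and so on, so it has at least one edge;
   repeated vertices are allowed, which does not change the set of endpoints. *)
Definition private_states (nx nu : nat) (A : 'M[bool]_nx)
    (B : 'M[bool]_(nx, nu)) (u : 'I_nu) : {set 'I_nx} :=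
  [set xk | `[< exists (x : 'I_nx) (p : seq 'I_nx),
     [/\ path (edge A B) (inr u) [seq inl z | z <- x :: p],
         last x p = xk &
         forall z, z \in x :: p ->
           forall u', u' != u -> ~~ adjacent A B (inl z) (inr u')] >]].

(* [xs y] is the state measured by the sensor [y]. *)
Definition g_gain (R : realType) (nx nu ns : nat) (A : 'M[bool]_nx)
    (B : 'M[bool]_(nx, nu)) (xs : 'I_ns -> 'I_nx) (k : 'I_nu -> nat)
    (u : 'I_nu) (Yp : {set 'I_ns}) : R :=
  Num.min (\sum_(y in Yp) #|[set xs y] :&: private_states A B u|%:R) (k u)%:R.

Definition G_gain (R : realType) (nx nu ns : nat) (A : 'M[bool]_nx)
    (B : 'M[bool]_(nx, nu)) (xs : 'I_ns -> 'I_nx) (k : 'I_nu -> nat)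
    (Yp : {set 'I_ns}) : R :=
  \sum_(u < nu) g_gain R A B xs k u Yp.

Definition nondecreasing_setfun (R : realType) (S : finType)
    (F : {set S} -> R) : Prop :=
  forall Sa Sb : {set S}, Sa \subset Sb -> F Sa <= F Sb.

Definition submodular (R : realType) (S : finType) (F : {set S} -> R) : Prop :=
  forall (Sa Sb : {set S}) (s : S), Sa \subset Sb -> s \notin Sb ->
    F (s |: Sb) - F Sb <= F (s |: Sa) - F Sa.

Definition integer_valued (R : realType) (S : finType)
    (F : {set S} -> R) : Prop :=
  forall X : {set S}, exists z : int, F X = z%:~R.

Record min_problem (S : finType) := MinProblem {
  objective : {set S} -> nat;
  feasible : pred {set S}
}.

Definition placement_problem (R : realType) (nx nu ns : nat)
    (A : 'M[bool]_nx) (B : 'M[bool]_(nx, nu)) (xs : 'I_ns -> 'I_nx)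
    (k : 'I_nu -> nat) : min_problem 'I_ns :=
  {| objective := fun Yp => #|Yp|;
     feasible := fun Yp => \sum_(u < nu) (k u)%:R <= G_gain R A B xs k Yp |}.

Definition cover_problem (R : realType) (S : finType) (F : {set S} -> R)
    (Fmax : nat) : min_problem S :=
  {| objective := fun Xp => #|Xp|;
     feasible := fun Xp => Fmax%:R <= F Xp |}.

Definition submodular_instance (R : realType) (S : finType)
    (P : min_problem S) (F : {set S} -> R) (Fmax : nat) : Prop :=
  (0 < #|S|)%N /\
  [/\ submodular F, nondecreasing_setfun F, integer_valued F & F set0 = 0] /\
  [/\ objective P =1 objective (cover_problem F Fmax) &
      feasible P =1 feasible (cover_problem F Fmax)].

(* Main.v *)
(** The number of sensors of [Yp] that measure a state of [private_states A B u] is a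
    modular function of [Yp] with nonnegative weights. Truncating it at [k u] composes it
    with the concave nondecreasing map [t |-> min (t, k u)], which makes it submodular and
    nondecreasing, and both properties are preserved by summation over the actuators. *)

Require Import Defs.
From mathcomp Require Import all_boot all_order all_algebra.
From mathcomp Require Import boolp reals.
From mathcomp Require Import lra.

Import Order.TTheory GRing.Theory Num.Theory.
Local Open Scope ring_scope.

Section SetFunctions.
Variables (R : realType) (S : finType).

Lemma submodular_sum (I : finType) (F : I -> {set S} -> R) :
  (forall i, submodular (F i)) -> submodular (fun X => \sum_i F i X).
Proof.
move=> subF Sa Sb s sab sNb; rewrite -!sumrB; apply: ler_sum => i _.
exact: subF.
Qed.

Lemma nondecreasing_setfun_sum (I : finType) (F : I -> {set S} -> R) :
  (forall i, nondecreasing_setfun (F i)) ->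
  nondecreasing_setfun (fun X => \sum_i F i X).
Proof. by move=> ndF Sa Sb sab; apply: ler_sum => i _; apply: ndF. Qed.

Lemma integer_valued_sum (I : finType) (F : I -> {set S} -> R) :
  (forall i, integer_valued (F i)) ->
  integer_valued (fun X => \sum_i F i X).
Proof.
(* The integers embedded in [R] contain 0 and are closed under addition. *)
move=> intF X; apply: (big_ind (fun r : R => exists z : int, r = z%:~R)).
- by exists 0.
- by move=> _ _ [z ->] [t ->]; exists (z + t); rewrite intrD.
- by move=> i _; apply: intF.
Qed.

Lemma integer_valued_min (F : {set S} -> R) (n : nat) :
  integer_valued F -> integer_valued (fun X => Num.min (F X) n%:R).
Proof.
move=> intF X; rewrite /Num.min; case: ifP => _; first exact: intF.
by exists n%:Z.
Qed.

Variable w : S -> R.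
Hypothesis w_ge0 : forall s, 0 <= w s.

Lemma nondecreasing_weight_sum :
  nondecreasing_setfun (fun X => \sum_(s in X) w s).
Proof.
move=> Sa Sb sab; rewrite [leRHS](big_setID Sa) /= (setIidPr sab).
by rewrite lerDl sumr_ge0.
Qed.

Lemma nondecreasing_truncated_sum (c : R) :
  nondecreasing_setfun (fun X => Num.min (\sum_(s in X) w s) c).
Proof. by move=> Sa Sb sab; rewrite le_min2 ?nondecreasing_weight_sum. Qed.

(** Adding [s] raises both weight sums by the same [w s], and the gain
    [min (t + w s, c) - min (t, c)] is nonincreasing in the starting value [t], which for [Sa] is at
    most that for [Sb]. *)
Lemma submodular_truncated_sum (c : R) :
  submodular (fun X => Num.min (\sum_(s in X) w s) c).
Proof.
move=> Sa Sb s sab sNb.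
have sNa : s \notin Sa by apply: contraNN sNb; apply: (subsetP sab).
rewrite !big_setU1 //=.
have := nondecreasing_weight_sum Sa Sb sab; have := w_ge0 s.
set a := \sum_(_ in Sa) _; set b := \sum_(_ in Sb) _ => ws0 ab.
(* Once the four minima are resolved, the claim is linear in [a], [b], [c] and [w s]. *)
by rewrite !minElt; do 4!case: ltP => ?; lra.
Qed.

End SetFunctions.

Theorem proposition7 (R : realType) (nx nu ns : nat)
    (A : 'M[bool]_nx) (B : 'M[bool]_(nx, nu))
    (hB : distinct_canonical_columns B)
    (ns_gt0 : (0 < ns)%N)
    (xs : 'I_ns -> 'I_nx) (k : 'I_nu -> nat) :
  submodular_instance (placement_problem R A B xs k)
    (G_gain R A B xs k) (\sum_(u < nu) k u)%N.
Proof.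
split; first by rewrite card_ord.
(* The two thresholds differ only in casting to [R] before or after summing [k]. *)
split; last by split=> // Yp /=; rewrite natr_sum.
split.
- by apply: submodular_sum => u; apply: submodular_truncated_sum.
- by apply: nondecreasing_setfun_sum => u; apply: nondecreasing_truncated_sum.
- apply: integer_valued_sum => u; apply: integer_valued_min => Yp.
  (* The integer witness is the same count taken in [nat]. *)
  by exists (\sum_(y in Yp) #|[set xs y] :&: private_states A B u|)%N%:Z; rewrite -natr_sum.
(* The empty sum is 0, and truncation keeps it since [k u] is nonnegative. *)
- by apply: big1 => u _; rewrite /g_gain big_set0 min_l.
Qed.
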